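(* Let $\mathcal{P}=(\mathcal{P},d,\mu)$ be a metric measure space such that $L^\infty(\mathcal{P})$ has the Vitali--Carathéodory property. Then the Sobolev capacity $C_\infty$ is an outer capacity. Moreover, the following three statements about $\mathcal{P}$ are equivalent: (A) Every $u\in N^{1,\infty}(\mathcal{P})$ is quasicontinuous. (F) Every $u\in N^{1,\infty}(\mathcal{P})$ has a quasicontinuous representative $v$, i.e. there is a quasicontinuous function $v:\mathcal{P}\to[-\infty,\infty]$ such that $C_\infty(\{x\in\mathcal{P}: v(x)\ne u(x)\})=0$. (G) Every $u\in N^{1,\infty}(\mathcal{P})$ is weakly quasicontinuous. Furthermore, there exists a metric measure space $\mathcal{P}$ for which $L^\infty(\mathcal{P})$ has the Vitali--Carathéodory property and (A), (F) and (G) all fail, and there exists a metric measure space $\mathcal{P}$ for which $L^\infty(\mathcal{P})$ has the Vitali--Carathéodory property and (A), (F) and (G) all hold.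
   Context: Standing assumption: a metric measure space $\mathcal{P}=(\mathcal{P},d,\mu)$ is a metric space equipped with a positive complete Borel measure $\mu$ such that $0<\mu(B)<\infty$ for every ball $B\subset\mathcal{P}$. Upper gradients: a Borel function $g:\mathcal{P}\to[0,\infty]$ is an upper gradient of $u:\mathcal{P}\to[-\infty,\infty]$ if $|u(\gamma(0))-u(\gamma(l_\gamma))|\le\int_\gamma g\,ds$ for every nonconstant rectifiable curve $\gamma:[0,l_\gamma]\to\mathcal{P}$ (parametrized by arc length, $l_\gamma$ being its length), with the convention $|(\pm\infty)-(\pm\infty)|=\infty$. Newtonian space: $N^{1,\infty}(\mathcal{P})$ is the set of all $u\in L^\infty(\mathcal{P})$ with $\|u\|_{N^{1,\infty}(\mathcal{P})}:=\|u\|_{L^\infty(\mathcal{P})}+\inf_g\|g\|_{L^\infty(\mathcal{P})}<\infty$, where the infimum is over all upper gradients $g$ of $u$. Functions in $N^{1,\infty}(\mathcal{P})$ are defined everywhere on $\mathcal{P}$ with values in $[-\infty,\infty]$ (not just up to a.e. equivalence). Capacity: for $E\subset\mathcal{P}$, $C_\infty(E)=\inf\{\|u\|_{N^{1,\infty}(\mathcal{P})}: u\ge 1\text{ on }E\}$ (infimum over $u\in N^{1,\infty}(\mathcal{P})$). $C_\infty$ is an outer capacity if $C_\infty(E)=\inf\{C_\infty(G): G\text{ open},\ G\supset E\}$ for every set $E\subset\mathcal{P}$. Quasicontinuity: a function $u:\mathcal{P}\to[-\infty,\infty]$ is weakly quasicontinuous if for every $\varepsilon>0$ there is a set $E\subset\mathcal{P}$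 with $C_\infty(E)<\varepsilon$ such that the restriction $u|_{\mathcal{P}\setminus E}$ is continuous. If the set $E$ can be chosen open for every $\varepsilon>0$, then $u$ is quasicontinuous. Vitali--Carathéodory property: $L^\infty(\mathcal{P})$ has the Vitali--Carathéodory property if for every measurable function $u:\mathcal{P}\to[-\infty,\infty]$, $\|u\|_{L^\infty(\mathcal{P})}=\inf\{\|v\|_{L^\infty(\mathcal{P})}: v\ge|u|\text{ on }\mathcal{P}\text{ and }v\text{ is lower semicontinuous on }\mathcal{P}\}$, where inequalities are pointwise everywhere. *)

(* Defs.v *)
From HB Require Import structures.
From mathcomp Require Import all_boot all_order all_algebra.
From mathcomp Require Import all_classical all_reals all_analysis.
From mathcomp Require Import measurable_realfun.

Set Implicit Arguments.
Unset Strict Implicit.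
Unset Printing Implicit Defensive.

Import Order.TTheory GRing.Theory Num.Theory.
Import numFieldNormedType.Exports.

Local Open Scope classical_set_scope.
Local Open Scope ring_scope.

(* A metric space with a sigma-algebra on the same carrier. Nothing relates the
   two here: that open sets are measurable is part of [metric_measure_space].
   As measurable types are pointed, the carrier is nonempty. *)
#[short(type="metricMeasurableType")]
HB.structure Definition MetricMeasurable (d : measure_display)
  (K : numDomainType) := {T of Metric K T & Measurable d T}.

Section curves.
Context (R : realType) (P : metricType R).
Implicit Types (gamma : R -> P) (a b l : R).

(* The analogue of [variation] for maps into a metric space. *)
Definition curve_variation a b gamma (s : seq R) : R :=
  let F := gamma \o nth b (a :: s) in
  \sum_(0 <= n < size s) mdist (F n) (F n.+1).

Definition curve_length a b gamma : \bar R :=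
  ereal_sup [set (curve_variation a b gamma s)%:E | s in itv_partition a b].

(* Rectifiable curves gamma : [0, l] -> P parametrized by arc length; the values
   of gamma outside [0, l] are irrelevant. Taking t = l, l is the length. *)
Definition arc_length_curve l gamma : Prop :=
  [/\ 0 <= l,
      {within `[0, l], continuous gamma} &
      forall t, t \in `[0, l] -> curve_length 0 t gamma = t%:E].

Definition nonconstant_curve l gamma : Prop :=
  exists s t, [/\ s \in `[0, l], t \in `[0, l] & gamma s <> gamma t].

End curves.

Local Open Scope ereal_scope.

Section newtonian_spaces.
Context (d : measure_display) (R : realType) (P : metricMeasurableType d R).
Implicit Types (u v g : P -> \bar R) (E G : set P).

Definition borel_function g : Prop :=
  measurable_fun [set: g_sigma_algebraType (@open P)] g.

(* In \bar R one has +oo - +oo = -oo - -oo = -oo, so that `|u x - u y| = +oo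
   whenever u x and u y are infinite with the same sign. *)
Definition upper_gradient u g : Prop :=
  [/\ borel_function g,
      forall x, 0 <= g x &
      forall (l : R) (gamma : R -> P),
        arc_length_curve l gamma -> nonconstant_curve l gamma ->
        `|u (gamma 0%R) - u (gamma l)| <=
          \int[lebesgue_measure]_(t in `[0%R, l]) g (gamma t)].

Context (mu : {measure set P -> \bar R}).

(* A complete Borel measure: the sigma-algebra contains the Borel sets and all
   subsets of null sets. *)
Definition metric_measure_space : Prop :=
  [/\ forall G, open G -> measurable G,
      measure_is_complete mu &
      forall (x : P) (r : R), (0 < r)%R -> 0 < mu (ball x r) < +oo].

Definition Linfty u : Prop :=
  measurable_fun [set: P] u /\ 'N[mu]_+oo[u] < +oo.

Definition N1oo_norm u : \bar R :=
  'N[mu]_+oo[u] + ereal_inf [set 'N[mu]_+oo[g] | g in upper_gradient u].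

Definition N1oo u : Prop := Linfty u /\ N1oo_norm u < +oo.

Definition capacity E : \bar R :=
  ereal_inf [set N1oo_norm u |
             u in [set u | N1oo u /\ forall x, E x -> 1 <= u x]].

Definition outer_capacity : Prop :=
  forall E,
    capacity E = ereal_inf [set capacity G | G in [set G | open G /\ E `<=` G]].

Definition weakly_quasicontinuous u : Prop :=
  forall e : R, (0 < e)%R ->
    exists E, capacity E < e%:E /\ {within ~` E, continuous u}.

Definition quasicontinuous u : Prop :=
  forall e : R, (0 < e)%R ->
    exists E, [/\ open E, capacity E < e%:E & {within ~` E, continuous u}].

Definition vitali_caratheodory : Prop :=
  forall u, measurable_fun [set: P] u ->
    'N[mu]_+oo[u] =
    ereal_inf [set 'N[mu]_+oo[v] | v in
                [set v | (forall x, `|u x| <= v x) /\ lower_semicontinuous v]].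

Definition every_N1oo_quasicontinuous : Prop :=
  forall u, N1oo u -> quasicontinuous u.

Definition every_N1oo_has_quasicontinuous_representative : Prop :=
  forall u, N1oo u ->
    exists v, quasicontinuous v /\ capacity [set x | v x <> u x] = 0.

Definition every_N1oo_weakly_quasicontinuous : Prop :=
  forall u, N1oo u -> weakly_quasicontinuous u.

End newtonian_spaces.

(* Main.v *)
(* Under the Vitali-Caratheodory property a measurable u satisfies
   |u| <= ||u||_oo at every point: a lower semicontinuous v >= |u| exceeds its
   essential supremum on a null open set, and since balls have positive measure
   that set is empty. Hence every nonempty set has capacity 1, and
   (weak) quasicontinuity is plain continuity. For the examples, {0} U {1/n} with
   atoms of positive mass has no nonconstant curves, so the indicator of {0} is a
   discontinuous element of N^{1,oo}; on a one-point space everything is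
   continuous. *)
From HB Require Import structures.
Require Import Defs.
From mathcomp Require Import all_boot all_order all_algebra.
From mathcomp Require Import all_classical all_reals all_analysis.
From mathcomp Require Import measurable_realfun ess_sup_inf lra zify.

Import Order.TTheory GRing.Theory Num.Theory.
Import numFieldNormedType.Exports.

Local Open Scope classical_set_scope.
Local Open Scope ring_scope.

(** * Pointwise bounds by the essential supremum *)

Lemma metric_ball_open {R : realType} {P : metricType R} (x : P) (r : R) :
  open (ball x r).
Proof.
rewrite openE => y; rewrite ballEmdist /= => xy.
apply/nbhs_ballP; exists (r - mdist x y) => /=; first by rewrite subr_gt0.
move=> z; rewrite !ballEmdist /= => yz.
by rewrite (le_lt_trans (metric_triangle _ y _))// -ltrBrDl.
Qed.

Section Lnorm_infty.
Local Open Scope ereal_scope.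
Context {d : measure_display} {R : realType} {P : metricMeasurableType d R}.
Context {mu : {measure set P -> \bar R}}.

Lemma Lnorm_oo_le (u : P -> \bar R) (c : \bar R) :
  0 <= c -> (forall x, `|u x| <= c) -> 'N[mu]_+oo[u] <= c.
Proof.
(* On a space of measure zero the norm is [0] by definition, whence [0 <= c]. *)
move=> c0 uc; rewrite unlock /Lnorm; case: ifPn => // _.
by apply/ess_supP; exact: nearW.
Qed.

Hypothesis mms : metric_measure_space mu.

Lemma open_measure_gt0 (G : set P) (x : P) : open G -> G x -> 0 < mu G.
Proof.
have [openm _ mu_ball] := mms.
move=> oG Gx; have /nbhs_ballP[e /= e0 eG] : nbhs x G by exact: open_nbhs_nbhs.
have /andP[B0 _] := mu_ball x e e0; apply: lt_le_trans B0 _.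
apply: le_measure; rewrite ?inE//; apply: openm => //; exact: metric_ball_open.
Qed.

Lemma lower_semicontinuous_le_Lnorm (v : P -> \bar R) (x : P) :
  lower_semicontinuous v -> v x <= 'N[mu]_+oo[v].
Proof.
move=> lscv; rewrite leNgt; apply/negP => Nv.
(* Superlevel sets are taken at real levels, so the norm must first be seen to be finite: it is
   nonnegative and strictly below [v x]. *)
have [r Nr] : exists2 r, 'N[mu]_+oo[v] = r%:E & r%:E < v x.
  move: Nv (Lnorm_ge0 mu +oo v); case: ('N[mu]_+oo[v]) => [r| |] //.
    by exists r.
  by rewrite ltNge leey.
move=> rv; have [openm _ _] := mms.
have oG : open [set y | r%:E < v y] by move/lower_semicontinuousP : lscv.
have muG := open_measure_gt0 _ x oG rv.
(* Positive total mass makes the norm an essential supremum. *)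
have muT : 0 < mu [set: P] by apply: (open_measure_gt0 _ x) => //; exact: openT.
have /ess_supP : ess_sup mu (abse \o v) <= r%:E.
  by rewrite -Nr unlock /Lnorm muT.
move=> aev; move: muG; rewrite measure_negligible ?ltxx//; first exact: openm.
apply: negligibleS aev => y /= ry /= vr.
by move: (lt_le_trans ry (le_trans (lee_abs _) vr)); rewrite ltxx.
Qed.

Hypothesis vc : vitali_caratheodory mu.

Lemma abse_le_Lnorm (u : P -> \bar R) (x : P) :
  measurable_fun [set: P] u -> `|u x| <= 'N[mu]_+oo[u].
Proof.
move=> mu_; rewrite vc//; apply: le_ereal_inf_tmp => _ [v [uv lscv] <-].
exact: le_trans (uv x) (lower_semicontinuous_le_Lnorm _ _ lscv).
Qed.

End Lnorm_infty.

(** * Capacity and quasicontinuity under the Vitali-Caratheodory property *)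

Section capacity.
Local Open Scope ereal_scope.
Context {d : measure_display} {R : realType} {P : metricMeasurableType d R}.
Context {mu : {measure set P -> \bar R}}.

Lemma upper_gradient_cst (c : R) :
  upper_gradient (cst c%:E : P -> \bar R) (cst 0).
Proof.
split=> // [|l gamma _ _]; first exact: measurable_cst.
by rewrite /cst subee// abse0 integral0.
Qed.

(** The zero upper gradient makes the gradient term vanish. This covers constants as well as the
    indicator in the counterexample. *)
Lemma N1oo_norm_le (u : P -> \bar R) (c : \bar R) :
  0 <= c -> (forall x, `|u x| <= c) -> upper_gradient u (cst 0) ->
  N1oo_norm mu u <= c.
Proof.
move=> c0 uc g0; rewrite -[leRHS]adde0; apply: leeD; first exact: Lnorm_oo_le.
apply: ge_ereal_inf; exists ('N[mu]_+oo[cst 0]); last by rewrite Lnorm0.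
by exists (cst 0).
Qed.

Lemma N1oo_bounded (u : P -> \bar R) (c : R) : (0 <= c)%R ->
  measurable_fun [set: P] u -> (forall x, `|u x| <= c%:E) ->
  upper_gradient u (cst 0) -> N1oo mu u.
Proof.
move=> c0 mu_ uc g0; split; first split => //.
  by apply: (@le_lt_trans _ _ c%:E); [exact: Lnorm_oo_le|exact: ltry].
by apply: (@le_lt_trans _ _ c%:E); [exact: N1oo_norm_le|exact: ltry].
Qed.

(** The constant [c] is the competitor. It is used with [c = 0] for the empty set, where the premise
    is vacuous, and with [c = 1] for arbitrary sets. *)
Lemma capacity_le_cst (E : set P) (c : R) : (0 <= c)%R ->
  (forall x, E x -> 1 <= c%:E) -> capacity mu E <= c%:E.
Proof.
move=> c0 Ec; have absc (x : P) : `|(cst c%:E : P -> \bar R) x| <= c%:E.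
  by rewrite /= ger0_norm.
apply: ge_ereal_inf; exists (N1oo_norm mu (cst c%:E)).
  exists (cst c%:E) => //; split => //.
  by apply: (N1oo_bounded _ c) => //; exact: upper_gradient_cst.
by apply: N1oo_norm_le => //; exact: upper_gradient_cst.
Qed.

Lemma N1oo_norm_ge_Lnorm (u : P -> \bar R) : 'N[mu]_+oo[u] <= N1oo_norm mu u.
Proof.
rewrite leeDl//; apply: le_ereal_inf_tmp => _ [g _ <-]; exact: Lnorm_ge0.
Qed.

Lemma capacity_ge0 (E : set P) : 0 <= capacity mu E.
Proof.
apply: le_ereal_inf_tmp => _ [u _ <-].
exact: le_trans (Lnorm_ge0 _ _ _) (N1oo_norm_ge_Lnorm _).
Qed.

Lemma capacity0 : capacity mu set0 = 0.
Proof.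
by apply/eqP; rewrite eq_le capacity_ge0 andbT; exact: capacity_le_cst.
Qed.

Hypothesis mms : metric_measure_space mu.
Hypothesis vc : vitali_caratheodory mu.

(** A competitor is at least [1] at the single point [x], which by [abse_le_Lnorm] already forces
    its norm to be at least [1]; the constant [1] attains this. *)
Lemma capacity_nonempty {E : set P} {x : P} : E x -> capacity mu E = 1.
Proof.
move=> Ex; apply/eqP; rewrite eq_le capacity_le_cst//=.
apply: le_ereal_inf_tmp => _ [u [[[mu_ _] _] u1] <-].
apply: le_trans (N1oo_norm_ge_Lnorm u).
apply: le_trans (abse_le_Lnorm mms vc _ x mu_).
exact: le_trans (u1 x Ex) (lee_abs _).
Qed.

Lemma capacity_lt1 (E : set P) : capacity mu E < 1 -> E = set0.
Proof.
move=> E1; apply/eqP; apply: contraLR E1 => /set0P[x Ex].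
by rewrite (capacity_nonempty Ex) ltxx.
Qed.

Lemma vc_outer_capacity : outer_capacity mu.
Proof.
move=> E; apply/eqP; rewrite eq_le; apply/andP; split.
  apply: le_ereal_inf_tmp => _ [G [_ EG] <-].
  have [->|/set0P[x Ex]] := eqVneq E set0.
    by rewrite capacity0 capacity_ge0.
  by rewrite (capacity_nonempty Ex) (capacity_nonempty (EG _ Ex)).
(* The infimum over open supersets is attained: by [set0] if [E] is empty, by the whole space
   otherwise. *)
apply: ge_ereal_inf; have [->|/set0P[x Ex]] := eqVneq E set0.
  by exists (capacity mu set0) => //; exists set0 => //;
    split => //; exact: open0.
exists (capacity mu setT); first by exists setT => //; split => //; exact: openT.
by rewrite (capacity_nonempty Ex) capacity_le_cst.
Qed.

(** At tolerance [1] the exceptional set has capacity below [1], hence is empty; conversely the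
    empty set serves for every tolerance. *)
Lemma weakly_quasicontinuousP (u : P -> \bar R) :
  weakly_quasicontinuous mu u <-> continuous u.
Proof.
split=> [/(_ 1%R ltr01)[E [/capacity_lt1 ->]]|cu e e0].
  by rewrite setC0 -continuous_subspace_setT.
exists set0; rewrite capacity0 lte_fin; split => //.
exact: continuous_subspaceT.
Qed.

Lemma quasicontinuousP (u : P -> \bar R) : quasicontinuous mu u <-> continuous u.
Proof.
split=> [qu|cu e e0].
  by apply/weakly_quasicontinuousP => e /qu[E [_ ? ?]]; exists E.
exists set0; rewrite capacity0 lte_fin; split => //; first exact: open0.
exact: continuous_subspaceT.
Qed.

Lemma capacity_eq0 (E : set P) : capacity mu E = 0 -> E = set0.
Proof. by move=> E0; apply: capacity_lt1; rewrite E0. Qed.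

(** A representative differs from [u] on a set of capacity zero, which is empty, so it is [u]
    itself. *)
Lemma quasicontinuous_representativeP :
  every_N1oo_quasicontinuous mu <->
  every_N1oo_has_quasicontinuous_representative mu.
Proof.
split=> [A u /A qu|F u /F[v [qv /capacity_eq0 vu]]].
  exists u; split=> //; rewrite [X in capacity mu X](_ : _ = set0) ?capacity0//.
  by rewrite -subset0 => x.
suff -> : u = v by [].
apply/funext => x; apply: contrapT => uv.
by rewrite -[False]/(set0 x) -vu => /esym.
Qed.

Lemma every_weakly_quasicontinuousP :
  every_N1oo_quasicontinuous mu <-> every_N1oo_weakly_quasicontinuous mu.
Proof.
split=> A u /A => [/quasicontinuousP|/weakly_quasicontinuousP] cu.
  exact/weakly_quasicontinuousP.
exact/quasicontinuousP.
Qed.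

End capacity.

(** * Finite measures that charge every point *)

Section atomic_spaces.
Local Open Scope ereal_scope.
Context {d : measure_display} {R : realType} {P : metricMeasurableType d R}.
Context {mu : {measure set P -> \bar R}}.
Hypothesis measurableA : forall A : set P, measurable A.
Hypothesis mu_fin : mu [set: P] < +oo.
Hypothesis mu_atom : forall x, 0 < mu [set x].

Lemma atomic_metric_measure_space : metric_measure_space mu.
Proof.
split=> // x r r0; apply/andP; split.
  apply: lt_le_trans (mu_atom x) _; apply: le_measure; rewrite ?inE//.
  by move=> _ ->; exact: ballxx.
by apply: le_lt_trans mu_fin; apply: le_measure; rewrite ?inE.
Qed.

(** A null set contains no point, so an almost everywhere bound holds everywhere. *)
Lemma atomic_abse_le_Lnorm (u : P -> \bar R) (x : P) : `|u x| <= 'N[mu]_+oo[u].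
Proof.
have muT : 0 < mu [set: P].
  by apply: lt_le_trans (mu_atom x) _; apply: le_measure; rewrite ?inE.
rewrite unlock /Lnorm muT leNgt; apply/negP => ux.
have : \forall y \ae mu, `|u y| <= ess_sup mu (abse \o u) by exact: ess_sup_ge.
move=> [N [_ muN uN]]; have := mu_atom x; rewrite ltNge -muN le_measure ?inE//.
by move=> _ ->; apply: uN => /=; apply/negP; rewrite -ltNge.
Qed.

Lemma atomic_vitali_caratheodory : vitali_caratheodory mu.
Proof.
move=> u _; apply/eqP; rewrite eq_le; apply/andP; split.
  apply: le_ereal_inf_tmp => _ [v [uv _] <-].
  apply: Lnorm_oo_le => [|x]; first exact: Lnorm_ge0.
  exact: le_trans (uv x) (le_trans (lee_abs _) (atomic_abse_le_Lnorm v x)).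
(* The constant function [c] is a lower semicontinuous majorant of [|u|] with norm at most [c], even
   if [c] is infinite. *)
set c := 'N[mu]_+oo[u]; apply: ge_ereal_inf; exists ('N[mu]_+oo[cst c]).
  exists (cst c) => //; split => [x|x a ac]; first exact: atomic_abse_le_Lnorm.
  by exists setT => //; exact: filterT.
by apply: Lnorm_oo_le => [|x]; rewrite ?gee0_abs//; exact: Lnorm_ge0.
Qed.

End atomic_spaces.

(** * The one-point space *)

Definition one_point (R : realType) : Type := unit.

Section one_point.
Context {R : realType}.

HB.instance Definition _ := Measurable.copy (one_point R) unit.

Let one_point_dist (x y : one_point R) : R := 0.

Let one_point_positivity (x y : one_point R) : one_point_dist x y = 0 -> x = y.
Proof. by case: x; case: y. Qed.

Let one_point_triangle (y x z : one_point R) :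
  one_point_dist x z <= one_point_dist x y + one_point_dist y z.
Proof. by rewrite addr0. Qed.

HB.instance Definition _ := isMetric.Build R (one_point R)
  (fun _ => erefl) one_point_positivity (fun _ _ => erefl) one_point_triangle.

End one_point.

(** * A sequence with its limit point: no nonconstant curves *)

(* [n] stands for the point [1 / n] of the real line, [0] for the limit point
   [0], as [0^-1 = 0]. *)
Definition inv_nat (R : realType) : Type := nat.

Section inv_nat.
Context {R : realType}.

HB.instance Definition _ := Measurable.copy (inv_nat R) nat.

Definition inv_nat_val (n : inv_nat R) : R := (n : nat)%:R^-1.

Let inv_nat_dist (m n : inv_nat R) : R := `|inv_nat_val m - inv_nat_val n|.

Let inv_nat_distxx (n : inv_nat R) : inv_nat_dist n n = 0.
Proof. by rewrite /inv_nat_dist subrr normr0. Qed.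

Let inv_nat_positivity (m n : inv_nat R) : inv_nat_dist m n = 0 -> m = n.
Proof.
move/normr0_eq0/eqP; rewrite subr_eq0 => /eqP/invr_inj/eqP.
by rewrite eqr_nat => /eqP.
Qed.

Let inv_nat_sym (m n : inv_nat R) : inv_nat_dist m n = inv_nat_dist n m.
Proof. exact: distrC. Qed.

Let inv_nat_triangle (n m p : inv_nat R) :
  inv_nat_dist m p <= inv_nat_dist m n + inv_nat_dist n p.
Proof. exact: ler_distD. Qed.

HB.instance Definition _ := isMetric.Build R (inv_nat R)
  inv_nat_distxx inv_nat_positivity inv_nat_sym inv_nat_triangle.

Lemma inv_nat_mdistE (m n : inv_nat R) :
  mdist m n = `|inv_nat_val m - inv_nat_val n|.
Proof. by []. Qed.

(** The distance is pulled back from the line, so the map is an isometry and each radius serves for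
    itself. *)
Lemma continuous_inv_nat_val : continuous inv_nat_val.
Proof.
move=> n A /nbhs_ballP[e e0 eA]; apply/nbhs_ballP; exists e => // m.
by rewrite ballEmdist => nm; apply: eA; exact: nm.
Qed.

(* [(n + 1/2)^-1] is a value missed between [1 / (n + 1)] and [1 / n], which a
   nonconstant curve would have to take. *)
Lemma inv_nat_gap (m n : inv_nat R) : inv_nat_val m < inv_nat_val n ->
  inv_nat_val m <= ((n : nat)%:R + 2^-1)^-1 <= inv_nat_val n.
Proof.
rewrite /inv_nat_val => mn.
have n0 : 0 < (n : nat)%:R :> R by rewrite -invr_gt0; apply: le_lt_trans mn.
have h0 : 0 < (n : nat)%:R + 2^-1 :> R by lra.
apply/andP; split; last by rewrite lef_pV2 ?posrE//; lra.
have [m0|m0] := posnP m; first by rewrite m0 invr0 invr_ge0 ltW.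
have m0' : 0 < (m : nat)%:R :> R by rewrite ltr0n.
(* Inversion turns the hypothesis into [n < m], so [n + 1 <= m] by integrality, which leaves room
   for [n + 1/2]. *)
move: mn; rewrite ltf_pV2 ?posrE// lef_pV2 ?posrE//.
by rewrite ltr_nat -(ler_nat R) -natr1; lra.
Qed.

(** Inversion is injective, also at [0], so equality would give [2 m = 2 n + 1], against parity. *)
Lemma inv_nat_val_half (m : inv_nat R) (n : nat) :
  inv_nat_val m <> (n%:R + 2^-1)^-1.
Proof.
move/invr_inj => mn; have : ((m : nat).*2 = n.*2.+1)%N.
  apply/eqP; rewrite -(eqr_nat R) -natr1 -!mul2n !natrM; apply/eqP.
  by rewrite mn; lra.
lia.
Qed.

(** Along a curve [inv_nat_val] is a continuous real function; two distinct values would force it,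
    by the intermediate value theorem, through the missed value of [inv_nat_gap]. *)
Lemma inv_nat_no_curve (l : R) (gamma : R -> inv_nat R) :
  arc_length_curve l gamma -> ~ nonconstant_curve l gamma.
Proof.
move=> [l0 cgamma _].
have ch : {within `[0, l], continuous (inv_nat_val \o gamma)}.
  move=> x.
  apply: (@continuous_comp (subspace `[0, l]) (inv_nat R) R gamma _ x (cgamma x)).
  exact: continuous_inv_nat_val.
suff lt_absurd s t : s \in `[0, l] -> t \in `[0, l] ->
    ~ inv_nat_val (gamma s) < inv_nat_val (gamma t).
  move=> [s [t [s0l t0l st]]]; apply: st; apply: mdist_positivity.
  rewrite inv_nat_mdistE; apply/eqP; rewrite normr_eq0 subr_eq0.
  by rewrite eq_le !leNgt; apply/andP; split; apply/negP; exact: lt_absurd.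
move=> s0l t0l /[dup] st /inv_nat_gap.
set v := (X in _ <= X <= _) => /andP[sv vt].
have csub a b : a \in `[0, l] -> b \in `[0, l] ->
    {within `[a, b], continuous (inv_nat_val \o gamma)}.
  rewrite !in_itv /= => /andP[a0 _] /andP[_ bl].
  apply: continuous_subspaceW ch => x /=; rewrite !in_itv /= => /andP[ax xb].
  by rewrite (le_trans a0 ax) (le_trans xb bl).
have hmin : Num.min (inv_nat_val (gamma s)) (inv_nat_val (gamma t)) <= v <=
    Num.max (inv_nat_val (gamma s)) (inv_nat_val (gamma t)).
  by rewrite ge_min sv le_max vt orbT.
(* The parameters [s] and [t] may come in either order, hence the bounds by [min] and [max]. *)
have [c cv] : exists c, inv_nat_val (gamma c) = v.
  have [le_st|/ltW le_ts] := leP s t.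
    by have [c _ cv] := IVT le_st (csub _ _ s0l t0l) hmin; exists c.
  rewrite minC maxC in hmin.
  by have [c _ cv] := IVT le_ts (csub _ _ t0l s0l) hmin; exists c.
exact: inv_nat_val_half cv.
Qed.

Lemma inv_nat_discontinuous :
  ~ continuous (fun n : inv_nat R => (n == 0%N :> nat)%:R%:E : \bar R).
Proof.
move=> /(_ 0%N [set y | 0 < y]%E) /=.
have nbhs1 : nbhs (1%:E : \bar R) [set y | 0 < y]%E.
  by apply: open_nbhs_nbhs; split; [exact: open_ereal_gt_ereal|exact: lte01].
(* Since [n] exceeds [e^-1], the point [1 / n] lies within [e] of the limit point, yet the indicator
   vanishes there. *)
move=> /(_ nbhs1)/nbhs_ballP[e /= e0]; set n := (Num.truncn e^-1).+1 => /(_ n) eu.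
have : ball (0%N : inv_nat R) e n.
  rewrite ballEmdist /= inv_nat_mdistE /inv_nat_val invr0 sub0r normrN.
  by rewrite ger0_norm ?invr_ge0// invf_plt ?posrE// truncnS_gt.
by move=> /eu /=; rewrite ltxx.
Qed.

End inv_nat.

(** * Assembly of the equivalences and of the two examples *)

Theorem theorem1p2 (R : realType) :
  (forall (d : measure_display) (P : metricMeasurableType d R)
      (mu : {measure set P -> \bar R}),
    metric_measure_space mu -> vitali_caratheodory mu ->
    outer_capacity mu /\
    (every_N1oo_quasicontinuous mu <->
     every_N1oo_has_quasicontinuous_representative mu) /\
    (every_N1oo_quasicontinuous mu <->
     every_N1oo_weakly_quasicontinuous mu)) /\
  (exists (d : measure_display) (P : metricMeasurableType d R)
      (mu : {measure set P -> \bar R}),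
    [/\ metric_measure_space mu, vitali_caratheodory mu,
        ~ every_N1oo_quasicontinuous mu,
        ~ every_N1oo_has_quasicontinuous_representative mu &
        ~ every_N1oo_weakly_quasicontinuous mu]) /\
  (exists (d : measure_display) (P : metricMeasurableType d R)
      (mu : {measure set P -> \bar R}),
    [/\ metric_measure_space mu, vitali_caratheodory mu,
        every_N1oo_quasicontinuous mu,
        every_N1oo_has_quasicontinuous_representative mu &
        every_N1oo_weakly_quasicontinuous mu]).
Proof.
split=> [d P mu mms vc|].
  split; first exact: vc_outer_capacity.
  split; first exact: quasicontinuous_representativeP.
  exact: every_weakly_quasicontinuousP.
split.
  (* The Poisson law of rate [1] is a probability with positive mass at every natural number. *)
  exists default_measure_display, (inv_nat R), (poisson_prob 1 0).
  have mA (A : set (inv_nat R)) : measurable A by [].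
  have fin : (poisson_prob (1 : R) 0 [set: inv_nat R] < +oo)%E.
    by rewrite probability_setT ltry.
  have atom (n : inv_nat R) : (0 < poisson_prob (1 : R) 0 [set n])%E.
    rewrite /poisson_prob ltr01 esum_set1 ?lee_fin ?poisson_pmf_ge0//.
    by rewrite lte_fin /poisson_pmf ltr01 expr1n mul1r mulr_gt0 ?expR_gt0//.
  have mms := atomic_metric_measure_space mA fin atom.
  have vc := atomic_vitali_caratheodory mA atom.
  have notA : ~ every_N1oo_quasicontinuous
      (poisson_prob (1 : R) 0 : {measure set (inv_nat R) -> \bar R}).
    move=> /(_ (fun n : inv_nat R => (n == 0%N :> nat)%:R%:E)) qc.
    apply: (@inv_nat_discontinuous R); apply/(quasicontinuousP mms vc)/qc.
    apply: (N1oo_bounded _ 1%R) => //.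
    - by move=> n; case: (_ == _); rewrite /= lee_fin ?normr1 ?normr0 ?ler01.
    (* Without nonconstant curves the upper gradient inequality is vacuous. *)
    - split=> // [|l gamma /inv_nat_no_curve//]; exact: measurable_cst.
  split=> //.
  - by move=> /(quasicontinuous_representativeP mms vc).
  - by move=> /(every_weakly_quasicontinuousP mms vc).
exists default_measure_display, (one_point R), (dirac tt).
have mA (A : set (one_point R)) : measurable A by [].
have fin : (dirac tt [set: one_point R] < +oo :> \bar R)%E.
  by rewrite diracT ltry.
have atom (x : one_point R) : (0 < dirac tt [set x] :> \bar R)%E.
  by rewrite diracE mem_set//; case: x.
have mms := atomic_metric_measure_space mA fin atom.
have vc := atomic_vitali_caratheodory mA atom.
have A : every_N1oo_quasicontinuous
    (dirac tt : {measure set (one_point R) -> \bar R}).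
  move=> u _; apply/(quasicontinuousP mms vc).
  rewrite (_ : u = cst (u tt)); first exact: cst_continuous.
  by apply/funext => -[].
split=> //.
- exact/(quasicontinuous_representativeP mms vc).
- exact/(every_weakly_quasicontinuousP mms vc).
Qed.
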